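(* Let $\sigma>0$, let $X\sim N(0,\sigma^2)$ be a Gaussian random variable, let $c=(2k+1)/(2j+1)$ with $k,j\in\{0,1,2,\dots\}$, and let $Y=X^c$. Then the kurtosis coefficient $\beta_2(c)$ of $Y$ is given by $$ \beta_2(c)=\frac{\int_{-\infty}^{\infty}\frac{1}{\sqrt{2\pi}}x^{4c}e^{-x^2/2}\,dx}{\left(\int_{-\infty}^{\infty}\frac{1}{\sqrt{2\pi}}x^{2c}e^{-x^2/2}\,dx\right)^2}=\sqrt{\pi}\,\frac{\Gamma\left(2c+\frac{1}{2}\right)}{\Gamma\left(c+\frac{1}{2}\right)^2}. $$
   Context: For $c=(2k+1)/(2j+1)$ with $k,j$ nonnegative integers, the power $x^c$ of a real number $x$ is the real odd power function: $x^c=\operatorname{sgn}(x)|x|^c$ (equivalently, the unique real $y$ with $y^{2j+1}=x^{2k+1}$), which is a bijection of $\mathbb{R}$. Accordingly $x^{2c}=(x^c)^2=|x|^{2c}$ and $x^{4c}=(x^c)^4=|x|^{4c}$. The kurtosis coefficient of a random variable $Y$ with finite fourth moment and positive variance is $E[(Y-E[Y])^4]/\left(E[(Y-E[Y])^2]\right)^2$ (so it equals 3 for a Gaussian variable). $\Gamma$ denotes the gamma function. *)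

(* Defs.v *)
From HB Require Import structures.
From mathcomp Require Import all_boot all_order all_algebra.
From mathcomp Require Import all_classical all_reals all_analysis.

Set Implicit Arguments.
Unset Strict Implicit.
Unset Printing Implicit Defensive.

Import Order.TTheory GRing.Theory Num.Theory.
Import numFieldNormedType.Exports.

Local Open Scope classical_set_scope.
Local Open Scope ring_scope.

Definition odd_powR (R : realType) (x c : R) : R := Num.sg x * `|x| `^ c.

Lemma odd_powRP (R : realType) (k j : nat) (x y : R) :
  y ^+ j.*2.+1 = x ^+ k.*2.+1 <->
  y = odd_powR x (k.*2.+1%:R / j.*2.+1%:R).
Proof.
have nz : (j.*2.+1%:R : R) != 0 by rewrite pnatr_eq0.
have sg_odd (z : R) n : Num.sg z ^+ n.*2.+1 = Num.sg z.
  by rewrite exprS -mul2n exprM sqr_sg; case: (eqVneq z 0) => [->|_];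
    rewrite ?sgr0 ?mul0r ?expr1n ?mulr1.
have inj : injective (fun z : R => z ^+ j.*2.+1).
  move=> a b /= e; rewrite [a]numEsg [b]numEsg.
  have -> : Num.sg a = Num.sg b by rewrite -(sg_odd a j) -(sg_odd b j) -!sgrX e.
  congr (_ * _); apply: (pexpIrn (n := j.*2.+1)) => //.
  by rewrite -!normrX e.
suff E : odd_powR x (k.*2.+1%:R / j.*2.+1%:R) ^+ j.*2.+1 = x ^+ k.*2.+1.
  by split=> [e|->//]; apply: inj => /=; rewrite E.
rewrite /odd_powR exprMn sg_odd -(powR_mulrn _ (powR_ge0 _ _)) -powRrM divfK//.
by rewrite powR_mulrn// -{1}(sg_odd x k) -exprMn -numEsg.
Qed.

(* Euler's integral, intended for s > 0 (where it converges). *)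
Definition Gamma (R : realType) (s : R) : R :=
  \int[lebesgue_measure]_(t in `]0, +oo[) (t `^ (s - 1) * expR (- t)).

Definition central_moment d (T : measurableType d) (R : realType)
    (P : probability T R) (Y : T -> R) (n : nat) : \bar R :=
  'E_P[fun w => (Y w - fine 'E_P[Y]) ^+ n].

(* Meaningful when Y has a finite fourth moment and a positive variance. *)
Definition kurtosis d (T : measurableType d) (R : realType)
    (P : probability T R) (Y : T -> R) : R :=
  fine (central_moment P Y 4) / fine (central_moment P Y 2) ^+ 2.

(* [normal_prob m s] takes the standard deviation s, not the variance. The laws
   are compared on measurable sets only: outside the sigma-algebra the two
   set functions take unrelated values, so equality of functions would be too
   strong. *)
Definition is_gaussian d (T : measurableType d) (R : realType)
    (P : probability T R) (X : {RV P >-> R}) (m s : R) : Prop :=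
  forall A : set R, measurable A -> distribution P X A = normal_prob m s A.

(* Main.v *)
(* With Z standard Gaussian, X has the law of sigma Z and |Y|^n = |X|^(n c). The
   substitution x = sigma sqrt(2 t) turns the even Gaussian integral into Euler's
   integral, E|X|^p = sigma^p 2^(p/2) Gamma((p+1)/2) / sqrt pi. Since Y is an odd
   function of X its mean vanishes, so the kurtosis is E|X|^(4c) / (E|X|^(2c))^2,
   in which the powers of sigma and of 2 cancel. Finiteness of Gamma((p+1)/2) is
   read off that formula with sigma = 1, bounding |x|^p by a multiple of
   exp(x^2/4). *)

Require Import Defs.
From HB Require Import structures.
From mathcomp Require Import all_boot all_order all_algebra.
From mathcomp Require Import all_classical all_reals all_analysis.
From mathcomp Require Import measurable_realfun ring lra.

Set Implicit Arguments.
Unset Strict Implicit.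
Unset Printing Implicit Defensive.

Import Order.TTheory GRing.Theory Num.Theory.
Import numFieldNormedType.Exports.

Local Open Scope classical_set_scope.
Local Open Scope ring_scope.

(** * Integration against a Gaussian law *)

(** Change of variables by the Radon-Nikodym derivative of [normal_prob]. It agrees almost
    everywhere with [normal_pdf], because the two have the same integral over every measurable
    set. *)
Lemma integral_normal_prob (R : realType) (m s : R) (f : _ -> \bar R) :
  measurable_fun setT f -> (forall x, 0 <= f x)%E ->
  (\int[normal_prob m s]_x f x =
   \int[lebesgue_measure]_x (f x * (normal_pdf m s x)%:E))%E.
Proof.
move=> mf f0.
have dom := @normal_prob_dominates R m s.
rewrite -(Radon_Nikodym_SigmaFinite.change_of_variables dom f0 measurableT mf).
have RNint := Radon_Nikodym_SigmaFinite.f_integrable dom.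
have mpdf : measurable_fun setT (fun x => (normal_pdf m s x)%:E).
  by apply/measurable_EFinP; exact: measurable_normal_pdf.
apply: ae_eq_integral => //.
- by apply: emeasurable_funM => //; exact: measurable_int RNint.
- exact: emeasurable_funM.
- apply: ae_eqe_mul2l; apply: integral_ae_eq => // E _ mE.
  by rewrite -Radon_Nikodym_SigmaFinite.f_integral.
Qed.

Lemma expectation_gaussian_ge0 d (T : measurableType d) (R : realType)
    (P : probability T R) (X : {RV P >-> R}) (m s : R) (f : R -> \bar R) :
  is_gaussian X m s -> measurable_fun setT f -> (forall x, 0 <= f x)%E ->
  (\int[P]_w f (X w) =
   \int[lebesgue_measure]_x (f x * (normal_pdf m s x)%:E))%E.
Proof.
move=> gX mf f0; rewrite -integral_normal_prob//.
pose X' : T -> measurableTypeR R := X.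
have mX' : measurable_fun setT X' by exact: measurable_funP X.
transitivity (\int[pushforward P X']_x f x)%E.
  by rewrite ge0_integral_pushforward.
by apply: eq_measure_integral => A mA _; exact: gX.
Qed.

(** * Reflection of Lebesgue integrals *)

Lemma ge0_integral_oppr (R : realType) (f : R -> \bar R) :
  measurable_fun setT f -> (forall x, 0 <= f x)%E ->
  (\int[lebesgue_measure]_x f (- x)%R = \int[lebesgue_measure]_x f x)%E.
Proof.
move=> mf f0.
transitivity (\int[pushforward lebesgue_measure
    (-%R : _ -> measurableTypeR R)]_x f x)%E.
  by rewrite ge0_integral_pushforward.
by apply: eq_measure_integral => A mA _; exact: lebesgue_measureN.
Qed.

Lemma ge0_integral_even (R : realType) (f : R -> \bar R) :
  measurable_fun setT f -> (forall x, 0 <= f x)%E ->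
  (forall x, f (- x)%R = f x) ->
  (\int[lebesgue_measure]_x f x =
   2%:E * \int[lebesgue_measure]_(x in `]0%R, +oo[) f x)%E.
Proof.
move=> mf f0 fe.
rewrite -(setUv `]-oo, 0%R]) setCitvl ge0_integral_setU//=; last 2 first.
- by rewrite -setCitvl setUv.
- rewrite disj_set2E; apply/eqP; rewrite -subset0 => x [/=].
  by rewrite !in_itv/= andbT leNgt => /negP.
under [X in (X + _)%E]eq_integral do rewrite -fe.
(* Reflecting the left half gives an integral over the closed half-line; dropping the null point 0
   makes the two halves equal. *)
rewrite -ge0_integration_by_substitution0// -integral_itv_obnd_cbnd; last first.
  exact: measurable_funTS.
by rewrite mule_natl mule2n.
Qed.

(** * The substitution x = a sqrt t on the open half-line *)

Lemma continuous_powR_gt0 (R : realType) (p x : R) :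
  0 < x -> {for x, continuous (@powR R ^~ p)}.
Proof.
move=> x0; apply/differentiable_continuous/derivable1_diffP.
by apply: derivable_powR; rewrite in_itv/= x0.
Qed.

Lemma bigcup_itvcc_gt0 (R : realType) :
  \bigcup_i `[i.+1%:R^-1, i.+1%:R]%classic = `]0, +oo[%classic :> set R.
Proof.
apply/seteqP; split => x /=.
  by move=> [i _]/=; rewrite !in_itv/= andbT => /andP[+ _]; exact: lt_le_trans.
rewrite in_itv/= andbT => x0.
(* With this index, [i.+1] exceeds both x and 1/x. *)
exists (maxn (Num.truncn x) (Num.truncn x^-1)) => //=.
rewrite in_itv/= invf_ple ?posrE//; apply/andP; split.
  apply: le_trans (ltW (truncnS_gt _)) _.
  by rewrite ler_nat ltnS leq_maxr.
apply: le_trans (ltW (truncnS_gt _)) _.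
by rewrite ler_nat ltnS leq_maxl.
Qed.

(* The library's substitution rule is applied on the compact intervals [1/n, n]:
   neither the derivative of the square root nor G need be continuous at 0. *)
Lemma integral_sqrt_substitution (R : realType) (a : R) (G : R -> R) :
  0 < a -> (forall x : R, 0 < x -> {for x, continuous G}) ->
  (forall x : R, 0 < x -> 0 <= G x) ->
  (\int[lebesgue_measure]_(x in `]0%R, +oo[) (G x)%:E =
   \int[lebesgue_measure]_(t in `]0%R, +oo[)
     (G (a * t `^ 2^-1) * (a * (2^-1 * t `^ (2^-1 - 1))))%:E)%E.
Proof.
move=> a0 cG G0.
pose F (t : R) := a * t `^ 2^-1.
pose F' (t : R) := a * (2^-1 * t `^ (2^-1 - 1)).
have F_gt0 (t : R) : 0 < t -> 0 < F t by move=> t0; rewrite mulr_gt0 ?powR_gt0.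
have dF (t : R) : 0 < t -> is_derive t 1 F (F' t).
  move=> t0; have D := is_derive1_powR 2^-1 t0.
  exact: (@is_deriveZ _ _ _ (@powR R ^~ 2^-1) a).
have cF' (t : R) : 0 < t -> {for t, continuous F'}.
  move=> t0; apply: cvgM; first exact: cvg_cst.
  by apply: cvgM; [exact: cvg_cst|exact: continuous_powR_gt0].
have cF (t : R) : 0 < t -> {for t, continuous F}.
  by move=> t0; apply: cvgM; [exact: cvg_cst|exact: continuous_powR_gt0].
have F1E (t : R) : 0 < t -> F^`()%classic t = F' t.
  by move=> t0; rewrite derive1E; apply: derive_val; exact: dF.
have cF1 (t : R) : 0 < t -> F^`()%classic x @[x --> t] --> F^`()%classic t.
  move=> t0; rewrite F1E//; apply: cvg_trans (cF' t t0).
  (* The derivative of [F] is known to be [F'] only at positive points, and all points close enough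
     to t are positive. *)
  apply: near_eq_cvg; near=> x; rewrite F1E//.
  by near: x; exact: lt_nbhsr.
have incrF (x y : R) : 0 < x -> x < y -> F x < F y.
  move=> x0 xy; rewrite ltr_pM2l// gt0_ltr_powR ?invr_gt0 ?nnegrE ?(ltW x0)//.
  by rewrite ltW// (lt_trans x0).
have ndF (x y : R) : 0 < x -> x <= y -> F x <= F y.
  by move=> x0; rewrite le_eqVlt => /predU1P[->//|/(incrF _ _ x0)/ltW].
have gt0_itv n (x : R) : `[n.+1%:R^-1, n.+1%:R]%classic x -> 0 < x.
  by rewrite /= in_itv/= => /andP[+ _]; apply: lt_le_trans.
have le_itv n : n.+1%:R^-1 <= n.+1%:R :> R.
  by rewrite (@le_trans _ _ 1)// ?invf_le1 ?ler1n.
have bigcupF : \bigcup_i `[F i.+1%:R^-1, F i.+1%:R]%classic =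
               `]0, +oo[%classic.
  apply/seteqP; split => x /=.
    move=> [i _]/=; rewrite !in_itv/= andbT => /andP[+ _].
    exact/lt_le_trans/F_gt0.
  rewrite in_itv/= andbT => x0.
  (* The preimage of x under [F] is (x / a)^2; an interval [1/n, n] containing it is carried by the
     monotone [F] to one containing x. *)
  have xa0 : 0 < (x / a) `^ 2 by apply: powR_gt0; apply: divr_gt0.
  have xE : F ((x / a) `^ 2) = x.
    rewrite /F -powRrM mulfV// powRr1 ?divr_ge0 ?ltW//.
    by rewrite mulrC divfK// gt_eqF.
  have : `]0, +oo[%classic ((x / a) `^ 2 : R) by rewrite /= in_itv/= xa0.
  rewrite -bigcup_itvcc_gt0 => -[i _]/=; rewrite in_itv/= => /andP[ix xi].
  by exists i => //=; rewrite in_itv/= -{1 2}xE !ndF.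
have mono (h : R -> R) : (forall x y, 0 < x -> x <= y -> h x <= h y) ->
    nondecreasing_seq (fun i : nat => `[h i.+1%:R^-1, h i.+1%:R]%classic).
  move=> hh n m nm; apply/subsetPset => x /=; rewrite !in_itv/=.
  move=> /andP[nx xn]; apply/andP; split.
    by apply: le_trans nx; apply: hh; rewrite ?lef_pV2 ?posrE// ler_nat ltnS.
  by apply: (le_trans xn); apply: hh; rewrite ?ler_nat ?ltnS.
have mG : measurable_fun (`]0, +oo[%classic : set R) G.
  apply: open_continuous_measurable_fun; first exact: interval_open.
  by move=> x /[!inE]/=; rewrite in_itv/= andbT => x0; exact: cG.
have cGFF' (t : R) : 0 < t -> {for t, continuous (fun t : R => G (F t) * F' t)}.
  move=> t0; apply: cvgM; last exact: cF'.
  by apply: continuous_comp; [exact: cF|exact/cG/F_gt0].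
have mGFF' : measurable_fun (`]0, +oo[%classic : set R)
    (fun t => G (F t) * F' t).
  apply: open_continuous_measurable_fun; first exact: interval_open.
  by move=> x /[!inE]/=; rewrite in_itv/= andbT => x0; exact: cGFF'.
(* Monotone convergence along growing compact intervals. It serves twice: with [h] equal to [F] for
   the integral in x, and to the identity for the integral in t. *)
have exhaust (h g : R -> R) :
    (forall x y : R, 0 < x -> x <= y -> h x <= h y) ->
    \bigcup_i `[h i.+1%:R^-1, h i.+1%:R]%classic = `]0, +oo[%classic ->
    measurable_fun (`]0, +oo[%classic : set R) g ->
    (forall x : R, 0 < x -> 0 <= g x) ->
    (\int[lebesgue_measure]_(x in `[h i.+1%:R^-1%R, h i.+1%:R%R]) (g x)%:E
       @[i --> \oo] --> \int[lebesgue_measure]_(x in `]0%R, +oo[) (g x)%:E)%E.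
  move=> hh hU mg g0; have sub i : `[h i.+1%:R^-1, h i.+1%:R]%classic
      `<=` `]0, +oo[%classic by rewrite -hU => x hx; exists i.
  rewrite -hU; apply: ge0_nondecreasing_set_cvg_integral => //.
  - exact: mono.
  - by move=> i; apply/measurable_EFinP; exact: measurable_funS mg.
  - move=> i x /sub; rewrite /= in_itv/= andbT lee_fin; exact: g0.
have F'_ge0 (t : R) : 0 < t -> 0 <= F' t.
  by move=> t0; rewrite !mulr_ge0 ?powR_ge0 ?invr_ge0// ltW.
have /cvg_lim <- // := exhaust F G ndF bigcupF mG G0.
have GFF'0 (t : R) : 0 < t -> 0 <= G (F t) * F' t.
  by move=> t0; rewrite mulr_ge0 ?F'_ge0// G0// F_gt0.
have /cvg_lim <- // := exhaust id (fun t => G (F t) * F' t)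
  (fun _ _ _ h => h) (@bigcup_itvcc_gt0 R) mGFF' GFF'0.
(* Both sides are now limits of integrals over compact intervals, which the substitution rule
   identifies index by index. *)
apply: congr_lim; apply/funext => i.
have in_gt0 (x : R) : x \in `]i.+1%:R^-1, i.+1%:R[ -> 0 < x.
  by rewrite in_itv/= => /andP[+ _]; apply: lt_trans.
have i0 : 0 < i.+1%:R^-1 :> R by [].
rewrite integration_by_substitution_increasing//.
- apply: eq_integral => x /[!inE] /gt0_itv x0.
  by rewrite !fctE F1E.
- move=> x y; rewrite !in_itv/= => /andP[ix _] _; apply: incrF.
  exact: lt_le_trans ix.
- by move=> x /in_gt0; exact: cF1.
- apply/cvg_ex; exists (F^`()%classic i.+1%:R^-1).
  by apply: cvg_at_right_filter; exact: cF1.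
- apply/cvg_ex; exists (F^`()%classic i.+1%:R).
  by apply: cvg_at_left_filter; exact: cF1.
- split.
  + by move=> x /in_gt0 /dF[].
  + by apply: cvg_at_right_filter; exact: cF.
  + by apply: cvg_at_left_filter; exact: cF.
- apply: continuous_in_subspaceT => x /[!inE]/=; rewrite in_itv/= => /andP[Fx _].
  by apply/cG/(lt_le_trans _ Fx)/F_gt0.
Unshelve. all: by end_near. Qed.

(** * Absolute Gaussian moments as Euler integrals *)

(* Extended-real version of Gamma, so that no convergence is presupposed. *)
Definition euler_integral (R : realType) (s : R) : \bar R :=
  (\int[lebesgue_measure]_(t in `]0%R, +oo[) (t `^ (s - 1) * expR (- t))%:E)%E.

Lemma euler_integral_ge0 (R : realType) (s : R) : (0 <= euler_integral s)%E.
Proof.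
by apply: integral_ge0 => x _; rewrite lee_fin mulr_ge0 ?powR_ge0 ?expR_ge0.
Qed.

(** Isolates s sqrt 2, the scale of the substitution below, so that it cancels against the
    derivative of the substitution. *)
Lemma normal_peakE (R : realType) (s : R) :
  0 <= s -> normal_peak s = (s * 2 `^ 2^-1 * Num.sqrt pi)^-1.
Proof.
move=> s0; rewrite /normal_peak powR12_sqrt//; congr (_^-1).
rewrite -mulr_natr -mulrA mulrC sqrtrM ?mulr_ge0 ?pi_ge0// mulrC.
by rewrite sqrtr_sqr ger0_norm// [pi * _]mulrC sqrtrM// mulrA.
Qed.

Lemma measurable_abs_powR_normal_pdf (R : realType) (s p : R) :
  measurable_fun setT (fun x : R => (`|x| `^ p * normal_pdf 0 s x)%:E).
Proof.
apply/measurable_EFinP; apply: measurable_funM.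
  by apply: (measurableT_comp (measurable_powR p)); exact: normr_measurable.
exact: measurable_normal_pdf.
Qed.

(** With x = s sqrt (2 t), the Gaussian exponent becomes -t and the powers of t combine as p/2 - 1/2
    = (p + 1)/2 - 1. The identity lives in [\bar R], where both sides may be infinite; finiteness is
    drawn from it later. *)
Lemma normal_abs_moment (R : realType) (s p : R) : 0 < s ->
  (\int[lebesgue_measure]_x (`|x| `^ p * normal_pdf 0 s x)%:E =
   (s `^ p * (2 `^ (p / 2) / Num.sqrt pi))%:E * euler_integral ((p + 1) / 2))%E.
Proof.
move=> s0; set a := s * 2 `^ 2^-1.
have a0 : 0 < a by rewrite mulr_gt0 ?powR_gt0.
have spi0 : Num.sqrt pi != 0 :> R by rewrite gt_eqF// sqrtr_gt0 pi_gt0.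
have f0 (x : R) : (0 <= (`|x| `^ p * normal_pdf 0 s x)%:E)%E.
  by rewrite lee_fin mulr_ge0 ?powR_ge0 ?normal_pdf_ge0.
rewrite ge0_integral_even//; last 2 first.
- exact: measurable_abs_powR_normal_pdf.
- move=> x; rewrite normrN; congr (_ * _)%:E.
  by rewrite !normal_pdfE ?gt_eqF// /normal_fun !subr0 sqrrN.
pose G (x : R) := x `^ p * normal_pdf 0 s x.
under eq_integral => x /[!inE]/=.
  rewrite in_itv/= andbT => x0; rewrite gtr0_norm// -/(G x); over.
rewrite (integral_sqrt_substitution a0); last 2 first.
- move=> x x0; apply: cvgM; first exact: continuous_powR_gt0.
  by apply: continuous_normal_pdf; rewrite gt_eqF.
- by move=> x x0; rewrite mulr_ge0 ?powR_ge0 ?normal_pdf_ge0.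
(* The 2 in the denominator comes from the derivative of the square root and will cancel the 2 due
   to evenness. *)
transitivity (2%:E * \int[lebesgue_measure]_(t in `]0%R, +oo[)
    ((a `^ p / (2 * Num.sqrt pi))%:E *
     (t `^ ((p + 1) / 2 - 1) * expR (- t))%:E))%E.
  congr (_ * _)%E; apply: eq_integral => t /[!inE]/=.
  rewrite in_itv/= andbT => t0; rewrite -EFinM; congr EFin.
  rewrite /G powRM ?powR_ge0 ?(ltW a0)// -powRrM normal_pdfE ?gt_eqF//.
  rewrite normal_peakE ?(ltW s0)// -/a /normal_fun subr0.
  have -> : - (a * t `^ 2^-1) ^+ 2 / (s ^+ 2 *+ 2) = - t.
    rewrite exprMn powR12_sqrt ?(ltW t0)// sqr_sqrtr ?(ltW t0)//.
    rewrite /a exprMn powR12_sqrt// sqr_sqrtr//.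
    by field; rewrite gt_eqF.
  have -> : (p + 1) / 2 - 1 = 2^-1 * p + (2^-1 - 1) by field.
  rewrite [in RHS]powRD; last by rewrite (gt_eqF t0) implybT.
  by field; rewrite spi0 gt_eqF.
rewrite ge0_integralZl//; last 3 first.
- apply/measurable_EFinP; apply: measurable_funTS; apply: measurable_funM.
    exact: measurable_powR.
  by apply: measurableT_comp => //; exact: measurableT_comp.
- by move=> x _; rewrite lee_fin mulr_ge0 ?powR_ge0 ?expR_ge0.
- by rewrite lee_fin divr_ge0 ?powR_ge0// mulr_ge0// sqrtr_ge0.
rewrite muleA -EFinM; congr (_%:E * _)%E.
rewrite /a powRM ?powR_ge0 ?(ltW s0)// -powRrM (mulrC 2^-1).
by field.
Qed.

(** * Finiteness and positivity of the absolute moments *)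

Lemma expr_le_expR (R : realType) (n : nat) (x : R) :
  0 <= x -> x ^+ n <= n`!%:R * expR x.
Proof.
move=> x0; case: n => [|n]; first by rewrite expr0 fact0 mul1r -expR0 ler_expR.
rewrite mulrC -ler_pdivrMr ?ltr0n ?fact_gt0//.
by apply: le_trans (expR_ge1Dxn n x0); rewrite lerDr.
Qed.

(** Half of the Gaussian exponent absorbs |x|^p; what remains is proportional to the Gaussian
    density of variance 2 s^2, that is, of standard deviation [r]. *)
Lemma normal_abs_moment_lty (R : realType) (s p : R) : 0 < s -> 0 <= p ->
  (\int[lebesgue_measure]_x (`|x| `^ p * normal_pdf 0 s x)%:E < +oo)%E.
Proof.
move=> s0 p0; pose r := s * Num.sqrt 2.
have r0 : 0 < r by rewrite mulr_gt0 ?sqrtr_gt0.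
(* With y = x^2 / (4 s^2) and n > p, |x|^p <= 1 + (x^2)^n = 1 + (4 s^2)^n y^n, and y^n <= n! exp y;
   this gives [C]. [K] also converts one density peak into the other. *)
pose n := (Num.truncn p).+1; pose C := 1 + (4 * s ^+ 2) ^+ n * n`!%:R.
pose K := C * (normal_peak s / normal_peak r).
have C0 : 0 <= C.
  by rewrite addr_ge0// mulr_ge0// exprn_ge0// mulr_ge0// sqr_ge0.
have K0 : 0 <= K by rewrite mulr_ge0// divr_ge0 ?normal_peak_ge0.
apply: (@le_lt_trans _ _
    (\int[lebesgue_measure]_x (K%:E * (normal_pdf 0 r x)%:E))%E); last first.
  rewrite ge0_integralZl//; last 2 first.
  - by apply/measurable_EFinP; exact: measurable_normal_pdf.
  - by move=> x _; rewrite lee_fin normal_pdf_ge0.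
  by rewrite integral_normal_pdf mule1 ltry.
apply: ge0_le_integral => //.
- by move=> x _; rewrite lee_fin mulr_ge0 ?powR_ge0 ?normal_pdf_ge0.
- exact: measurable_abs_powR_normal_pdf.
- apply: measurable_funeM; apply/measurable_EFinP; exact: measurable_normal_pdf.
move=> x _; rewrite -EFinM lee_fin !normal_pdfE ?gt_eqF//.
have powR_le : `|x| `^ p <= C * expR (x ^+ 2 / (4 * s ^+ 2)).
  have s4 : 0 < 4 * s ^+ 2 by rewrite mulr_gt0// exprn_gt0.
  have y0 : 0 <= x ^+ 2 / (4 * s ^+ 2) by rewrite divr_ge0 ?sqr_ge0 ?ltW.
  apply: (@le_trans _ _ (1 + (x ^+ 2) ^+ n)).
    (* The summand 1 covers |x| <= 1; beyond that, |x|^p <= |x|^n <= |x|^(2n). *)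
    have [x1|x1] := leP `|x| 1.
      rewrite (@le_trans _ _ 1)//; last by rewrite lerDl exprn_ge0// sqr_ge0.
      by have := ge0_ler_powR p0 _ _ x1; rewrite powR1; apply; rewrite nnegrE.
    rewrite (@le_trans _ _ (`|x| `^ n%:R))//.
      by rewrite ler_powR ?ltW// truncnS_gt.
    rewrite powR_mulrn// -[leLHS]add0r lerD// -real_normK ?num_real//.
    by rewrite -exprM ler_eXn2l// leq_pmull.
  rewrite /C mulrDl mul1r lerD//; first by rewrite -[leLHS]expR0 ler_expR.
  rewrite -[X in X ^+ n](divfK (lt0r_neq0 s4)) exprMn.
  by rewrite mulrC -[leRHS]mulrA ler_wpM2l ?exprn_ge0 ?(ltW s4)// expr_le_expR.
apply: (@le_trans _ _ (C * expR (x ^+ 2 / (4 * s ^+ 2)) *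
    (normal_peak s * normal_fun 0 s x))).
  by rewrite ler_wpM2r// mulr_ge0 ?normal_peak_ge0 ?normal_fun_ge0.
have -> : normal_fun 0 r x = expR (x ^+ 2 / (4 * s ^+ 2)) * normal_fun 0 s x.
  rewrite /normal_fun -expRD !subr0; congr expR.
  rewrite /r exprMn sqr_sqrtr//.
  by field; rewrite gt_eqF.
rewrite /K; have : normal_peak r != 0 by rewrite gt_eqF ?normal_peak_gt0 ?gt_eqF.
by move=> pr0; rewrite le_eqVlt; apply/orP; left; apply/eqP; field.
Qed.

(** On [1, 2] the power is at least 1 and the density at least its value [m] at 2, so the integral
    is at least [m]. *)
Lemma normal_abs_moment_gt0 (R : realType) (s p : R) : 0 < s -> 0 <= p ->
  (0 < \int[lebesgue_measure]_x (`|x| `^ p * normal_pdf 0 s x)%:E)%E.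
Proof.
move=> s0 p0.
pose m := normal_peak s * expR (- 2 ^+ 2 / (s ^+ 2 *+ 2)).
have m0 : 0 < m by rewrite mulr_gt0 ?expR_gt0// normal_peak_gt0// gt_eqF.
apply: (@lt_le_trans _ _
    (\int[lebesgue_measure]_(x in `[1%R, 2%R]) (cst m%:E x))%E).
  rewrite integral_cst//= lebesgue_measure_itv/= lte_fin ltr1n.
  by rewrite -EFinB -EFinM lte_fin mulr_gt0// subr_gt0 ltr1n.
have f0 (x : R) : (0 <= (`|x| `^ p * normal_pdf 0 s x)%:E)%E.
  by rewrite lee_fin mulr_ge0 ?powR_ge0 ?normal_pdf_ge0.
apply: (@le_trans _ _ (\int[lebesgue_measure]_(x in `[1%R, 2%R])
    (`|x| `^ p * normal_pdf 0 s x)%:E)%E); last first.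
  apply: ge0_subset_integral => //; exact: measurable_abs_powR_normal_pdf.
apply: ge0_le_integral => //.
- by move=> x _; rewrite lee_fin ltW.
- by apply: measurable_funTS; exact: measurable_abs_powR_normal_pdf.
move=> x; rewrite /= in_itv/= => /andP[x1 x2].
have x0 : 0 <= x by rewrite (le_trans _ x1).
rewrite lee_fin ger0_norm// normal_pdfE ?gt_eqF// -[leLHS]mul1r ler_pM ?(ltW m0)//.
  by have := ge0_ler_powR p0 _ _ x1; rewrite powR1; apply; rewrite nnegrE.
rewrite /m ler_wpM2l ?normal_peak_ge0// ler_expR subr0.
rewrite ler_wpM2r ?invr_ge0 ?mulrn_wge0 ?sqr_ge0// lerN2.
by rewrite ler_sqr ?nnegrE.
Qed.

(** * Values of Gamma from 1/2 on, and closed moments *)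

(** [Gamma] is the [fine] of Euler's integral, which would send an infinite value to 0, so
    convergence must be proved. The bound 1/2 on s = (p + 1)/2 amounts to p >= 0; an infinite
    integral would make the moment of order p infinite. *)
Lemma GammaE (R : realType) (s : R) : 2^-1 <= s ->
  euler_integral s = (Gamma s)%:E.
Proof.
move=> s2; pose p := 2 * s - 1.
have p0 : 0 <= p by rewrite /p; lra.
have sE : s = (p + 1) / 2 by rewrite /p; field.
rewrite /Gamma /Rintegral -/(euler_integral s) fineK//.
rewrite ge0_fin_numE ?euler_integral_ge0//.
rewrite ltNge leye_eq; apply/eqP => sy.
have := normal_abs_moment_lty (@ltr01 R) p0.
rewrite normal_abs_moment// -sE sy powR1 mul1r gt0_muley ?ltxx//.
by rewrite lte_fin divr_gt0 ?powR_gt0 ?sqrtr_gt0 ?pi_gt0.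
Qed.

Lemma Gamma_gt0 (R : realType) (s : R) : 2^-1 <= s -> 0 < Gamma s.
Proof.
move=> s2; pose p := 2 * s - 1.
have p0 : 0 <= p by rewrite /p; lra.
have sE : s = (p + 1) / 2 by rewrite /p; field.
have := normal_abs_moment_gt0 (@ltr01 R) p0.
rewrite normal_abs_moment// -sE GammaE// -EFinM lte_fin powR1 mul1r.
by rewrite pmulr_rgt0// divr_gt0 ?powR_gt0 ?sqrtr_gt0 ?pi_gt0.
Qed.

(* Closed form of E|Z|^p for Z standard Gaussian. *)
Definition normal_moment (R : realType) (p : R) : R :=
  2 `^ (p / 2) / Num.sqrt pi * Gamma ((p + 1) / 2).

Lemma normal_moment_gt0 (R : realType) (p : R) : 0 <= p -> 0 < normal_moment p.
Proof.
move=> p0; rewrite mulr_gt0 ?Gamma_gt0//; last by lra.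
by rewrite divr_gt0 ?powR_gt0 ?sqrtr_gt0 ?pi_gt0.
Qed.

Lemma normal_abs_momentE (R : realType) (s p : R) : 0 < s -> 0 <= p ->
  (\int[lebesgue_measure]_x (`|x| `^ p * normal_pdf 0 s x)%:E =
   (s `^ p * normal_moment p)%:E)%E.
Proof.
move=> s0 p0; rewrite normal_abs_moment// GammaE; last by lra.
by rewrite -EFinM -mulrA.
Qed.

(** * The odd power function *)

Lemma measurable_odd_powR (R : realType) (c : R) :
  measurable_fun setT (fun x : R => odd_powR x c).
Proof.
apply: measurable_funM; last first.
  by apply: (measurableT_comp (measurable_powR c)); exact: normr_measurable.
(* The sign factor is measurable because it is monotone. *)
apply: nondecreasing_measurable => // x y xy.
have [x0|x0|x0] := ltrgt0P x; have [y0|y0|y0] := ltrgt0P y;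
  rewrite ?x0 ?y0 ?sgr0 ?(gtr0_sg x0) ?(gtr0_sg y0) ?(ltr0_sg x0) ?(ltr0_sg y0);
  lra.
Qed.

Lemma odd_powRN (R : realType) (c x : R) : odd_powR (- x) c = - odd_powR x c.
Proof. by rewrite /odd_powR sgrN normrN mulNr. Qed.

(** The case c = 0 is excluded because of x = 0, where the sign gives 0 but the power 0^0 is 1. *)
Lemma normr_odd_powR (R : realType) (c x : R) :
  c != 0 -> `|odd_powR x c| = `|x| `^ c.
Proof.
move=> c0; rewrite /odd_powR normrM normr_sg (ger0_norm (powR_ge0 _ _)).
by have [->|] := eqVneq x 0; rewrite ?normr0 ?powR0 ?mulr0// mul1r.
Qed.

Lemma odd_powR_even_exp (R : realType) (c x : R) (n : nat) : c != 0 ->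
  odd_powR x c ^+ n.*2 = `|x| `^ (n.*2%:R * c).
Proof.
move=> c0; rewrite mulrC powRrM -normr_odd_powR// powR_mulrn//.
by rewrite -mul2n !exprM real_normK// num_real.
Qed.

(** * Moments of odd functions and powers of a Gaussian variable *)

(** With g = max(f, 0), the positive and negative parts of f(X) are g(X) and g(-X), whose integrals
    agree by symmetry of the density. Integrability makes this common value finite, so that the
    difference is 0. *)
Lemma expectation_gaussian_odd d (T : measurableType d) (R : realType)
    (P : probability T R) (X : {RV P >-> R}) (s : R) (f : R -> R) :
  0 < s -> is_gaussian X 0 s -> measurable_fun setT f ->
  (forall x, f (- x) = - f x) ->
  P.-integrable setT (EFin \o f \o X) ->
  ('E_P[f \o X] = 0)%E.
Proof.
move=> s0 gX mf fN intf; rewrite unlock.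
pose g (x : R) : \bar R := (Num.max (f x) 0)%:E.
have mg : measurable_fun setT g.
  by apply/measurable_EFinP; exact: measurable_maxr.
have mgN : measurable_fun setT (g \o -%R).
  by apply: measurableT_comp => //.
have g0 x : (0 <= g x)%E by rewrite lee_fin le_max lexx orbT.
have fpos : ((EFin \o f \o X)^\+ = g \o X)%E.
  by apply/funext => w; rewrite funeposE /g/= EFin_max.
have fneg : ((EFin \o f \o X)^\- = g \o -%R \o X)%E.
  by apply/funext => w; rewrite funenegE /g/= fN EFin_max.
have E : (\int[P]_w (g (- X w)%R) = \int[P]_w (g (X w)))%E.
  rewrite (expectation_gaussian_ge0 gX mg g0).
  rewrite (expectation_gaussian_ge0 gX mgN (fun x => g0 _)).
  pose h x := (g x * (normal_pdf 0 s x)%:E)%E.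
  rewrite -(@ge0_integral_oppr _ h).
  - apply: eq_integral => x _ /=; congr (_ * _%:E)%E.
    by rewrite !normal_pdfE ?gt_eqF// /normal_fun !subr0 sqrrN.
  - apply: emeasurable_funM => //; apply/measurable_EFinP.
    exact: measurable_normal_pdf.
  - by move=> x; rewrite mule_ge0// lee_fin normal_pdf_ge0.
rewrite integralE -/(EFin \o f \o X) fpos fneg/= E subee//.
rewrite -/(g \o X) -fpos; exact/integrable_fin_num/integrable_funepos.
Qed.

Lemma gaussian_abs_moment d (T : measurableType d) (R : realType)
    (P : probability T R) (X : {RV P >-> R}) (s p : R) :
  0 < s -> 0 <= p -> is_gaussian X 0 s ->
  (\int[P]_w (`|X w| `^ p)%:E = (s `^ p * normal_moment p)%:E)%E.
Proof.
move=> s0 p0 gX; rewrite -normal_abs_momentE//.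
rewrite (expectation_gaussian_ge0 (f := fun x => (`|x| `^ p)%:E) gX)//.
apply/measurable_EFinP; apply: (measurableT_comp (measurable_powR p)).
exact: normr_measurable.
Qed.

(** Identifies the two integrals of the theorem, n = 2 and n = 1, as absolute moments of the
    standard Gaussian, the case s = 1. *)
Lemma Rintegral_gaussian_odd_powR (R : realType) (c : R) (n : nat) : 0 < c ->
  \int[lebesgue_measure]_x ((Num.sqrt (2 * pi))^-1 * odd_powR x c ^+ n.*2
     * expR (- (x ^+ 2 / 2))) = normal_moment (n.*2%:R * c).
Proof.
move=> c0; rewrite /Rintegral.
transitivity (fine (1 `^ (n.*2%:R * c) * normal_moment (n.*2%:R * c))%:E).
  rewrite -normal_abs_momentE ?mulr_ge0 ?(ltW c0)//.
  congr fine; apply: eq_integral => x _; congr EFin.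
  rewrite odd_powR_even_exp ?gt_eqF// normal_pdfE ?oner_eq0//.
  rewrite /normal_peak /normal_fun subr0 expr1n mul1r mulr_natl mulNr.
  by rewrite mulrCA mulrA.
by rewrite /= powR1 mul1r.
Qed.

(** * Kurtosis of an odd power *)

Theorem proposition2p1 (d : measure_display) (T : measurableType d)
    (R : realType) (P : probability T R) (sigma : R) (X : {RV P >-> R})
    (k j : nat) (c : R) (Y : T -> R)
    (sigma_gt0 : 0 < sigma)
    (X_gauss : is_gaussian X 0 sigma)
    (cE : c = (2 * k + 1)%:R / (2 * j + 1)%:R)
    (YE : Y = fun w => odd_powR (X w) c) :
  [/\ Y \in Lfun P 4%:E,
      (0 < 'V_P[Y])%E,
      kurtosis P Y =
        (\int[lebesgue_measure]_x
           ((Num.sqrt (2 * pi))^-1 * odd_powR x c ^+ 4 * expR (- (x ^+ 2 / 2))))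
        / (\int[lebesgue_measure]_x
           ((Num.sqrt (2 * pi))^-1 * odd_powR x c ^+ 2 * expR (- (x ^+ 2 / 2))))
          ^+ 2 &
      (\int[lebesgue_measure]_x
         ((Num.sqrt (2 * pi))^-1 * odd_powR x c ^+ 4 * expR (- (x ^+ 2 / 2))))
        / (\int[lebesgue_measure]_x
           ((Num.sqrt (2 * pi))^-1 * odd_powR x c ^+ 2 * expR (- (x ^+ 2 / 2))))
          ^+ 2
      = Num.sqrt pi * Gamma (2 * c + 1 / 2) / Gamma (c + 1 / 2) ^+ 2].
Proof.
have c0 : 0 < c by rewrite cE divr_gt0// ltr0n addn1.
have cn0 : c != 0 by rewrite gt_eqF.
have evenmom n : (\int[P]_w (Y w ^+ n.*2)%:E =
    (sigma `^ (n.*2%:R * c) * normal_moment (n.*2%:R * c))%:E)%E.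
  rewrite -(gaussian_abs_moment _ _ X_gauss) ?mulr_ge0 ?(ltW c0)//.
  by apply: eq_integral => w _; rewrite YE odd_powR_even_exp.
have mY : measurable_fun setT Y.
  rewrite YE; apply: (measurableT_comp (measurable_odd_powR c)).
  exact: measurable_funP.
have Y4 : Y \in Lfun P 4%:E.
  rewrite inE; apply/andP; split; rewrite inE//=.
  rewrite /finite_norm unlock/= -/(EFin \o Y) poweR_lty//.
  under eq_integral => w _ do rewrite powR_mulrn//.
  have -> : (\int[P]_w (`|Y w| ^+ 4)%:E = \int[P]_w (Y w ^+ 2.*2)%:E)%E.
    apply: eq_integral => w _; congr EFin.
    by rewrite -normrX ger0_norm// exprn_even_ge0.
  by rewrite evenmom ltry.
(* On a probability space, L^4 is contained in L^1. *)
have Y1 : P.-integrable setT (EFin \o Y).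
  apply/Lfun1_integrable; move: Y4; apply: Lfun_subset;
    by rewrite ?lee1n ?fin_num_measure.
have EY0 : ('E_P[Y] = 0)%E.
  move: Y1; rewrite YE => Y1.
  apply: (expectation_gaussian_odd (f := fun x => odd_powR x c)
    sigma_gt0 X_gauss) => //.
  - exact: measurable_odd_powR.
  - exact: odd_powRN.
(* The mean being 0, even central moments are the raw moments [evenmom]. *)
have cm n : central_moment P Y n.*2 =
    (sigma `^ (n.*2%:R * c) * normal_moment (n.*2%:R * c))%:E.
  rewrite -evenmom /central_moment EY0 unlock.
  by apply: eq_integral => w _; rewrite subr0.
have c2 : 0 < normal_moment (2%:R * c) :> R.
  by rewrite normal_moment_gt0// mulr_ge0// ltW.
have I4 := @Rintegral_gaussian_odd_powR R c 2 c0.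
have I2 := @Rintegral_gaussian_odd_powR R c 1 c0.
split; first exact: Y4.
- have -> : ('V_P[Y] = central_moment P Y 1.*2)%E.
    by rewrite /variance unlock /central_moment; congr expectation.
  by rewrite cm lte_fin mulr_gt0// powR_gt0.
- rewrite I4 I2 /kurtosis (cm 2%N) (cm 1%N)/=.
  (* Written as a square, the power of sigma cancels against the squared denominator. *)
  have -> : sigma `^ (4 * c) = (sigma `^ (2 * c)) ^+ 2.
    by rewrite -powR_mulrn ?powR_ge0// -powRrM; congr (_ `^ _); ring.
  have s2 : sigma `^ (2 * c) != 0 by rewrite gt_eqF// powR_gt0.
  by field; rewrite s2 gt_eqF.
- rewrite I4 I2 /normal_moment/=.
  have -> : (4 * c + 1) / 2 = 2 * c + 1 / 2 by field.
  have -> : (2 * c + 1) / 2 = c + 1 / 2 by field.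
  (* The powers of 2 cancel likewise, while 1 / sqrt pi over its own square leaves the factor sqrt
     pi. *)
  have -> : 2 `^ (4 * c / 2) = (2 `^ (2 * c / 2)) ^+ 2 :> R.
    by rewrite -powR_mulrn ?powR_ge0// -powRrM; congr (_ `^ _); field.
  have G0 : Gamma (c + 1 / 2) != 0.
    by rewrite gt_eqF// Gamma_gt0//; lra.
  have p0 : Num.sqrt pi != 0 :> R by rewrite gt_eqF// sqrtr_gt0 pi_gt0.
  have t0 : 2 `^ (2 * c / 2) != 0 :> R by rewrite gt_eqF// powR_gt0.
  by field; rewrite G0 p0.
Qed.
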